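(* Let $k\geq 3$ and let $\Gamma_k$ be the marked group $\mathbb{Z}/k\mathbb{Z}\times\mathbb{Z}$ with generating set consisting of the elements $(i,0)$ for $i\neq 0$, $(i,1)$ for $i\notin\{0,1\}$, and $(-i,-1)$ for $i\notin\{0,1\}$ (where $i$ ranges over $\mathbb{Z}/k\mathbb{Z}$). Then $\chi_B(F(2^{\Gamma_k}))=k$.
   Context: A marked group is a finitely generated group $\Gamma$ with a finite symmetric generating set $S$ not containing the identity. The left shift action of $\Gamma$ on $2^\Gamma$ is $(g\cdot x)(h)=x(g^{-1}h)$; its free part is $F(2^\Gamma)=\{x\in 2^\Gamma : g\cdot x\neq x \text{ for all } g\neq \mathrm{id}\}$. The shift graph $F(2^\Gamma)$ is the graph on this free part joining distinct $x,y$ iff $s\cdot x=y$ for some $s\in S$. $\chi_B(G)$ denotes the Borel chromatic number: the least $k$ such that there is a Borel map $c$ from the vertex set to a $k$-element set with $c(x)\neq c(y)$ for adjacent $x,y$. *)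

(* Defs.v *)
From HB Require Import structures.
From mathcomp Require Import all_boot all_order all_algebra all_fingroup.
From mathcomp Require Import all_classical all_reals all_analysis.

Set Implicit Arguments.
Unset Strict Implicit.
Unset Printing Implicit Defensive.

Import GRing.Theory.
Local Open Scope classical_set_scope.

Definition generates (Gam : groupType) (S : set Gam) : Prop :=
  forall H : set Gam,
    H 1%g ->
    (forall g h, H g -> H h -> H (g * h)%g) ->
    (forall g, H g -> H g^-1%g) ->
    S `<=` H -> H = [set: Gam].

Definition marking (Gam : groupType) (S : set Gam) : Prop :=
  [/\ finite_set S, (forall s, S s -> S s^-1%g), ~ S 1%g & generates S].

(* 2^Gam with the product topology, each factor bool being discrete *)
Definition pow2 (Gam : groupType) : topologicalType :=
  prod_topology (fun _ : Gam => bool).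

Definition shift (Gam : groupType) (g : Gam) (x : pow2 Gam) : pow2 Gam :=
  fun h => x (g^-1 * h)%g.

Definition free_part (Gam : groupType) : set (pow2 Gam) :=
  [set x | forall g : Gam, g <> 1%g -> shift g x <> x].
Arguments free_part : clear implicits.

(* The vertex space F(2^Gam): [set_type] carries the subspace topology. *)
Definition F2 (Gam : groupType) : topologicalType :=
  set_type (free_part Gam).

Definition shift_graph (Gam : groupType) (S : set Gam) (x y : F2 Gam) : Prop :=
  x <> y /\ exists2 s, S s & shift s (set_val x) = set_val y.

(* [<<s open >>] is the Borel sigma-algebra of X; 'I_n is discrete. *)
Definition borel_map (X : topologicalType) (n : nat) (c : X -> 'I_n) : Prop :=
  forall A : set 'I_n, <<s @open X >> (c @^-1` A).

Definition borel_colorable (X : topologicalType) (E : X -> X -> Prop)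
    (n : nat) : Prop :=
  exists2 c : X -> 'I_n, borel_map c & forall x y, E x y -> c x <> c y.

(* chi_B (X, E) = n *)
Definition borel_chromatic_number_eq (X : topologicalType)
    (E : X -> X -> Prop) (n : nat) : Prop :=
  borel_colorable E n /\ forall m, borel_colorable E m -> (n <= m)%N.

(* Z/k x Z written multiplicatively; 'Z_k is Z/kZ only for k > 1. *)
Definition Gamma (k : nat) : groupType :=
  Algebra.to_multiplicative ('Z_k * int)%type.

Local Open Scope ring_scope.

Definition Gamma_gens (k : nat) : set (Gamma k) :=
  [set s | [\/ exists2 i : 'Z_k, i <> 0 & s = (i, 0),
               exists2 i : 'Z_k, i <> 0 /\ i <> 1 & s = (i, 1)
             | exists2 i : 'Z_k, i <> 0 /\ i <> 1 & s = (- i, -1)]].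
Arguments Gamma_gens : clear implicits.

Lemma Gamma_gens_marking (k : nat) : (3 <= k)%N -> marking (Gamma_gens k).
Proof.
move=> k3; split.
- pose D := [set: 'Z_k] `*` ((fun n : 'I_3 => n%:Z - 1) @` [set: 'I_3]).
  apply: (@sub_finite_set _ _ D); last first.
    apply: finite_setX; first exact: finite_finset.
    by apply: finite_image; exact: finite_finset.
  move=> _ [[i _ ->]|[i _ ->]|[i _ ->]]; split=> //=.
  + by exists (inord 1); rewrite ?inordK.
  + by exists (inord 2); rewrite ?inordK.
  + by exists (inord 0); rewrite ?inordK.
- move=> _ [[i i0 ->]|[i i01 ->]|[i i01 ->]].
  + apply: Or31; exists (- i); last by congr pair; rewrite oppr0.
    by move/eqP; rewrite oppr_eq0 => /eqP.
  + by apply: Or33; exists i.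
  + by apply: Or32; exists i => //; congr pair; rewrite opprK.
- by case=> -[i i0 []] //; move=> e; case: i0.
- move=> H H1 HM HV SH; rewrite -subTset => -[a n] _.
  have HA (b : 'Z_k) : H (b, 0).
    have [->|/eqP b0] := eqVneq b 0; first exact: H1.
    by apply: SH; apply: Or31; exists b.
  have two : (2 : 'Z_k) <> 0 /\ (2 : 'Z_k) <> 1.
    have k1 : (1 < k)%N by exact: leq_trans k3.
    split=> [/(congr1 (@nat_of_ord _))|e].
      by rewrite val_Zp_nat // modn_small.
    have /eqP[] := oner_neq0 'Z_k.
    by apply: (@addrI _ 1); rewrite addr0.
  pose mk (b : 'Z_k) (m : int) : Gamma k := (b, m).
  have mkM b m c l : (mk b m * mk c l)%g = mk (b + c) (m + l) by [].
  have mkV b m : (mk b m)^-1%g = mk (- b) (- m) by [].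
  have H01 : H (mk 0 1).
    have H21 : H (mk 2 1) by apply: SH; apply: Or32; exists 2.
    by move: (HM _ _ (HA (- 2)) H21); rewrite (mkM (- 2) 0) addNr add0r.
  have HN (m : nat) : H (mk 0 m%:Z).
    elim: m => [|m IH]; first exact: H1.
    by move: (HM _ _ H01 IH); rewrite mkM addr0 -intS.
  have HZ : H (mk 0 n).
    case: n => m; first exact: HN.
    by move: (HV _ (HN m.+1)); rewrite mkV oppr0 NegzE.
  by move: (HM _ _ (HA a) HZ); rewrite (mkM a 0) addr0 add0r.
Qed.

(* Main.v *)
(** In an orbit of the free part, each coset of Z/k x {0} is a k-clique, which
    gives the lower bound.  A k-colouring of an orbit amounts to a choice, for
    each level n, of a rotation t_n of Z/k with t_(n+1) - t_n in {0, 1}, the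
    point (a, n) receiving the colour a - t_n.  Countably many clopen sets, each
    containing at most one point of every window of k consecutive levels, cover
    the free part; the first of them meeting a given orbit selects in a Borel
    way a nonempty set of markers in that orbit, at distance at least k.  One
    lets t_m = p at a marker (p, m); since consecutive markers are at least k
    levels apart, t can climb from one marker to the next by steps in {0, 1},
    and it is kept constant before the first and after the last marker. *)

From mathcomp Require Import all_boot all_order all_algebra all_fingroup.
From mathcomp Require Import all_classical all_analysis.
From mathcomp Require Import zify.
Require Import Defs.

Set Implicit Arguments.
Unset Strict Implicit.
Unset Printing Implicit Defensive.

Import GRing.Theory.
Local Open Scope classical_set_scope.

(** * Closure of Borel predicates under countable logical operations *)

Section BorelPredicates.
Variable X : topologicalType.
Implicit Types P Q : X -> Prop.

Definition borel_pred P : Prop := <<s @open X >> [set x | P x].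

Lemma borel_pred_open P : open [set x | P x] -> borel_pred P.
Proof. by move=> oP; apply: sub_sigma_algebra. Qed.

Lemma borel_pred_not P : borel_pred P -> borel_pred (fun x => ~ P x).
Proof.
have [_ hC _] := smallest_sigma_algebra [set: X] (@open X).
by move=> /hC; rewrite setTD.
Qed.

Lemma borel_pred_exists (I : countType) (P : I -> X -> Prop) :
  (forall i, borel_pred (P i)) -> borel_pred (fun x => exists i, P i x).
Proof.
move=> bP.
have [h0 _ hU] := smallest_sigma_algebra [set: X] (@open X).
rewrite /borel_pred; pose F n := if unpickle n is Some i then [set x | P i x] else set0.
have -> : [set x | exists i, P i x] = \bigcup_n F n.
  apply/seteqP; split=> x /=.
    by case=> i Pi; exists (pickle i) => //; rewrite /F pickleK.
  by case=> n _; rewrite /F; case: (unpickle n) => // i Pi; exists i.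
by apply: hU => n; rewrite /F; case: (unpickle n) => [i|//]; exact: bP.
Qed.

Lemma borel_pred_forall (I : countType) (P : I -> X -> Prop) :
  (forall i, borel_pred (P i)) -> borel_pred (fun x => forall i, P i x).
Proof.
move=> bP.
have -> : (fun x => forall i, P i x) = (fun x => ~ exists i, ~ P i x).
  by apply/funext => x; apply/propext; rewrite -forallNE; split=> h i;
    [move=> nP; exact: nP | apply: contrapT; exact: h].
apply: borel_pred_not; apply: borel_pred_exists => i.
exact: borel_pred_not.
Qed.

Lemma borel_pred_and P Q :
  borel_pred P -> borel_pred Q -> borel_pred (fun x => P x /\ Q x).
Proof.
move=> bP bQ.
have -> : (fun x => P x /\ Q x) = (fun x => forall b : bool, if b then P x else Q x).
  apply/funext => x; apply/propext; split=> [[? ?] []//|h].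
  by split; [exact: (h true)|exact: (h false)].
by apply: borel_pred_forall => -[].
Qed.

Lemma borel_pred_cst (A : Prop) : borel_pred (fun=> A).
Proof.
apply: borel_pred_open; have [a|na] := pselect A.
  by rewrite (_ : [set _ | _] = setT) ?predeqE//; exact: openT.
by rewrite (_ : [set _ | _] = set0) ?predeqE//; exact: open0.
Qed.

Lemma borel_pred_imply (A : Prop) P :
  borel_pred P -> borel_pred (fun x => A -> P x).
Proof.
move=> bP; have [a|na] := pselect A.
  by rewrite (_ : (fun x => A -> P x) = P)// funeqE => x; apply/propext; split; auto.
rewrite (_ : (fun x => A -> P x) = (fun=> True)); first exact: borel_pred_cst.
by rewrite funeqE => x; apply/propext; split.
Qed.

End BorelPredicates.

Lemma borel_pred_coord (Gam : groupType) (g : Gam) (b : bool) :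
  borel_pred (fun x : F2 Gam => (set_val x : pow2 Gam) g = b).
Proof.
apply: borel_pred_open.
have cval : continuous (set_val : F2 Gam -> pow2 Gam) by exact: initial_continuous.
have cpr : continuous (fun x : pow2 Gam => x g : bool).
  exact: (@proj_continuous Gam (fun=> bool) g).
have /continuousP := fun x => continuous_comp (cval x) (@cpr _).
by move=> /(_ [set b]); apply; exact: discrete_open.
Qed.

(** * The shift action and point masses *)

Lemma shiftM (Gam : groupType) (g h : Gam) (x : pow2 Gam) :
  shift g (shift h x) = shift (g * h)%g x.
Proof. by apply/funext => a; rewrite /shift invgM mulgA. Qed.

Lemma shift1 (Gam : groupType) (x : pow2 Gam) : shift 1%g x = x.
Proof. by apply/funext => a; rewrite /shift invg1 mul1g. Qed.

Section Point.
Variable Gam : groupType.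

(** The point masses form a single free orbit, a copy of the group inside the free part; the lower
    bound finds its clique there. *)
Definition point_mass (a : Gam) : pow2 Gam := fun h => h == a.

Lemma point_mass_inj : injective point_mass.
Proof.
by move=> a b /(congr1 (@^~ a)); rewrite /point_mass eqxx => /esym/eqP.
Qed.

Lemma point_mass_free (a : Gam) : free_part Gam (point_mass a).
Proof.
move=> g g1 /(congr1 (fun x : pow2 Gam => x (g * a)%g)).
rewrite /shift /point_mass mulKg eqxx => /esym/eqP e; apply: g1.
by apply: (mulIg a); rewrite mul1g.
Qed.

Lemma shift_point_mass (g a : Gam) :
  shift g (point_mass a) = point_mass (g * a)%g.
Proof.
by apply/funext => h; rewrite /shift /point_mass (can2_eq (mulKVg g) (mulKg g)).
Qed.

Definition free_point_mass (a : Gam) : F2 Gam :=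
  exist _ (point_mass a) (mem_set (@point_mass_free a)).

End Point.

(** * Separated Borel markers in each orbit *)

Section Markers.
Variable k : nat.
Local Open Scope ring_scope.

Definition gam (g : 'Z_k * int) : Gamma k := g.

Lemma gamM g h : (gam g * gam h)%g = gam (g + h).
Proof. by []. Qed.

Definition window (d : 'Z_k * 'I_k) : 'Z_k * int := (d.1, (d.2 : nat)%:Z).

(* [e d] records a coordinate at which a point and its translate by [window d]
   differ, together with the value of the point there. *)
Definition cell_index : countType := {ffun 'Z_k * 'I_k -> ('Z_k * int) * bool}.

Definition cell (e : cell_index) (y : pow2 (Gamma k)) : Prop :=
  forall d, window d <> 0 ->
    y (gam (e d).1) = (e d).2 /\
    y ((gam (window d))^-1 * gam (e d).1)%g = ~~ (e d).2.

(** Among all cells met by the orbit, the one with the least code is selected. Minimality is tested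
    on the whole orbit, so the selection does not depend on the base point. *)
Definition marker (x : pow2 (Gamma k)) (g : 'Z_k * int) : Prop :=
  exists e : cell_index, cell e (shift (gam g) x) /\
    forall e' : cell_index, (pickle e' < pickle e)%N ->
    forall h, ~ cell e' (shift (gam h) x).

(** With [w] for [window d], membership of both points would force [y] to take opposite values at
    the single coordinate [w^-1 * (e d).1]. *)
Lemma cell_window e y d :
  window d <> 0 -> cell e y -> ~ cell e (shift (gam (window d)) y).
Proof.
move=> d0 /(_ _ d0)[_ e1] /(_ _ d0)[e2 _].
by move: e2; rewrite /shift e1; case: (e d).2.
Qed.

Lemma free_cell x : free_part (Gamma k) x -> exists e, cell e x.
Proof.
move=> fx.
have ch d : exists hb : ('Z_k * int) * bool, window d <> 0 ->
    x (gam hb.1) = hb.2 /\ x ((gam (window d))^-1 * gam hb.1)%g = ~~ hb.2.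
  (* The pair [(0, true)] is a dummy: a zero displacement imposes no condition. *)
  have [d0|d0] := pselect (window d = 0); first by exists (0, true).
  have /existsNP[h hx] : ~ forall h, shift (gam (window d)) x h = x h.
    by move=> /funext; exact: fx.
  exists (h, x h) => _; split=> //.
  move: hx; rewrite /shift /gam /=.
  by case: (x h); case: (x _).
have [f fP] := choice ch.
by exists [ffun d => f d] => d d0; rewrite ffunE; exact: fP.
Qed.

Lemma marker_exists x : free_part (Gamma k) x -> exists g, marker x g.
Proof.
move=> fx; pose P n := `[< exists e : cell_index, pickle e = n /\
  exists g, cell e (shift (gam g) x) >].
have exP : exists n, P n.
  have [e ce] := free_cell fx; exists (pickle e); apply/asboolP; exists e; split=> //.
  by exists 0; rewrite (_ : shift _ _ = x)//; exact: shift1.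
case: (ex_minnP exP) => n /asboolP[e [en [g ceg]]] nmin.
exists g, e; split=> // e' lt_e' h ceh.
have : P (pickle e') by apply/asboolP; exists e'; split=> //; exists h.
by move=> /nmin; rewrite -en leqNgt lt_e'.
Qed.

Lemma marker_shift x g h : marker (shift (gam g) x) h <-> marker x (h + g).
Proof.
split=> -[e [ce emin]]; exists e; split.
- by move: ce; rewrite shiftM gamM.
- move=> e' /emin {}emin a ca; apply: (emin (a - g)).
  by rewrite shiftM gamM subrK.
- by rewrite shiftM gamM.
- by move=> e' /emin {}emin a; rewrite shiftM gamM; exact: emin.
Qed.

(** By minimality of the codes, two markers of one orbit lie in the same cell, and a cell is
    disjoint from its nonzero window translates. *)
Lemma marker_window x g d :
  marker x g -> marker x (window d + g) -> window d = 0.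
Proof.
move=> [e [ce emin]] [e' [ce' emin']]; apply: contrapT => d0.
have ee' : e = e'.
  apply: (pcan_inj pickleK); apply/eqP; rewrite eqn_leq; apply/andP.
  split; rewrite leqNgt; apply/negP.
    by move=> /emin /(_ _ ce').
  by move=> /emin' /(_ _ ce).
apply: (cell_window d0 ce).
by rewrite shiftM gamM ee'.
Qed.

Lemma marker_separated x (p q : 'Z_k) (m : int) (j : nat) : (j < k)%N ->
  marker x (p, m) -> marker x (q, m + j%:Z) -> p = q /\ j = 0.
Proof.
move=> jk mp mq.
have w0 : window (q - p, Ordinal jk) = 0.
  apply: (marker_window mp).
  rewrite (_ : _ + _ = (q, m + j%:Z)) //.
  by rewrite /window/=; congr pair; [rewrite subrK|rewrite addrC].
by have /subr0_eq -> := congr1 fst w0; have [->] := congr1 snd w0.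
Qed.

Lemma borel_marker g :
  borel_pred (fun x : F2 (Gamma k) => marker (set_val x) g).
Proof.
have bcell e h : borel_pred (fun x : F2 (Gamma k) => cell e (shift (gam h) (set_val x))).
  apply: borel_pred_forall => d; apply: borel_pred_imply.
  by apply: borel_pred_and; exact: borel_pred_coord.
apply: borel_pred_exists => e; apply: borel_pred_and; first exact: bcell.
apply: borel_pred_forall => e'; apply: borel_pred_imply.
by apply: borel_pred_forall => h; apply: borel_pred_not; exact: bcell.
Qed.

End Markers.

(** * Interpolating the rotation between markers *)

Section Rotation.
Variable k : nat.
Hypothesis k_gt1 : (1 < k)%N.
Local Open Scope ring_scope.
Implicit Types (f : 'Z_k -> nat -> Prop) (u v : option ('Z_k * nat)).
Implicit Types (x : pow2 (Gamma k)) (i t : 'Z_k).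

Definition nearest f u : Prop :=
  match u with
  | Some (p, j) => f p j /\ forall q l, (l < j)%N -> ~ f q l
  | None => forall p j, ~ f p j
  end.

Lemma nearest_exists f : exists u, nearest f u.
Proof.
have [exf|nexf] := pselect (exists n, `[< exists p, f p n >]); last first.
  by exists None => p j fpj; apply: nexf; exists j; apply/asboolP; exists p.
case: (ex_minnP exf) => n /asboolP[p fpn] nmin.
exists (Some (p, n)); split=> // q l ln fql.
have /nmin : `[< exists p, f p l >] by apply/asboolP; exists q.
by rewrite leqNgt ln.
Qed.

Lemma nearest_uniq f u v : (forall p q j, f p j -> f q j -> p = q) ->
  nearest f u -> nearest f v -> u = v.
Proof.
move=> fu; case: u => [[p j]|]; case: v => [[q l]|] //=.
- move=> [fp jmin] [fq lmin].
  have jl : j = l.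
    apply/eqP; rewrite eqn_leq; apply/andP; split; rewrite leqNgt; apply/negP.
      by move=> h; exact: jmin h fq.
    by move=> h; exact: lmin h fp.
  by subst l; rewrite (fu _ _ _ fp fq).
- by move=> [fp _] /(_ p j).
- by move=> nf [/nf].
Qed.

Definition rotate i u := omap (fun pj => (pj.1 - i, pj.2)) u.

Lemma nearest_rotate f f' i u : (forall p j, f' p j <-> f (p + i) j) ->
  nearest f u -> nearest f' (rotate i u).
Proof.
move=> ff'; case: u => [[p j]|] /=.
  move=> [fp jmin]; split; first by apply/ff'; rewrite subrK.
  by move=> q l lj /ff'; exact: jmin.
by move=> nf p j /ff'; exact: nf.
Qed.

(* [before x] and [after x] list the markers at levels <= 0 and >= 1. *)
Definition before x (p : 'Z_k) (j : nat) := marker x (p, - j%:Z).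
Definition after x (p : 'Z_k) (j : nat) := marker x (p, j.+1%:Z).

(** The representative below [k] of [q - p]: the number of unit steps that lead from [p] up to
    [q]. *)
Definition gap (p q : 'Z_k) : nat := (q - p)%R.
Arguments gap : simpl never.

Lemma gap_rotate i p q : gap (p - i) (q - i) = gap p q.
Proof. by rewrite /gap opprB addrA subrK. Qed.

Lemma gap_lt p q : (gap p q < k)%N.
Proof. by rewrite -[X in (_ < X)%N](Zp_cast k_gt1) ltn_ord. Qed.

(** The value of t at level 0: starting from [p] at the last marker, [j] levels below, t gains one
    per level until it reaches [q], then waits for the next marker. The value [0] for two missing
    markers is a default. *)
Definition interpolate u v : 'Z_k :=
  match u, v with
  | Some (p, j), Some (q, _) => p + (minn j (gap p q))%:R
  | Some (p, _), None => p
  | None, Some (q, _) => q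
  | None, None => 0
  end.

Definition rotation x t := exists uv,
  [/\ nearest (before x) uv.1, nearest (after x) uv.2
    & t = interpolate uv.1 uv.2].

Lemma rotation_exists x : exists t, rotation x t.
Proof.
have [u nu] := nearest_exists (before x).
have [v nv] := nearest_exists (after x).
by exists (interpolate u v), (u, v).
Qed.

Lemma marker_level x (p q : 'Z_k) (m : int) :
  marker x (p, m) -> marker x (q, m) -> p = q.
Proof.
move=> mp mq; have := @marker_separated _ x p q m 0 (ltnW k_gt1) mp.
by rewrite addr0 => /(_ mq)[].
Qed.

Lemma rotation_uniq x t t' : rotation x t -> rotation x t' -> t = t'.
Proof.
move=> [[u v] /= [nu nv ->]] [[u' v'] /= [nu' nv' ->]].
congr interpolate.
  by apply: nearest_uniq nu nu' => p q j; exact: marker_level.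
by apply: nearest_uniq nv nv' => p q j; exact: marker_level.
Qed.

(** Rotating both ends preserves the gap. The default [0] is not moved by the rotation, so at least
    one marker must exist. *)
Lemma interpolate_rotate i u v : u <> None \/ v <> None ->
  interpolate (rotate i u) (rotate i v) = interpolate u v - i.
Proof.
case: u => [[p j]|]; case: v => [[q l]|] //=; last by case.
by rewrite gap_rotate addrAC.
Qed.

Lemma nearest_marker x u v : free_part (Gamma k) x ->
  nearest (before x) u -> nearest (after x) v -> u <> None \/ v <> None.
Proof.
move=> /marker_exists[[p m] mp].
case: u => [?|/= nb]; first by left.
case: v => [?|/= na]; first by right.
case: m mp => [[|j]|j] mp.
- by have [] := nb p 0%N; rewrite /before oppr0.
- by have [] := na p j.
- by have [] := nb p j.+1; rewrite /before -NegzE.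
Qed.

Lemma rotation_clique x i t : free_part (Gamma k) x ->
  rotation x t -> rotation (shift (gam (i, 0)) x) (t - i).
Proof.
move=> fx [[u v] /= [nu nv ->]]; exists (rotate i u, rotate i v); split=> /=.
- apply: nearest_rotate nu => p j; rewrite /before marker_shift.
  by rewrite (_ : _ + _ = (p + i, - j%:Z)) //; congr pair; rewrite addr0.
- apply: nearest_rotate nv => p j; rewrite /after marker_shift.
  by rewrite (_ : _ + _ = (p + i, j.+1%:Z)) //; congr pair; rewrite addr0.
- by rewrite interpolate_rotate //; exact: nearest_marker nu nv.
Qed.

(** Level 0 of the shifted point is level 1 of [x], so [b] is the increment of t from level 0 to
    level 1, and [- i] comes from the change of base point within the level. *)
Lemma rotation_step x i t : free_part (Gamma k) x -> rotation x t ->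
  exists b : bool, rotation (shift (gam (i, 1)) x) (t - i + b%:R).
Proof.
move=> fx [[u v] /= [nu nv ->]].
have nz := nearest_marker fx nu nv.
set y := shift _ x.
have b0 p : before y p 0 <-> after x (p + i) 0.
  rewrite /before /after marker_shift.
  by rewrite (_ : _ + _ = (p + i, 1)) //; congr pair; rewrite oppr0 add0r.
have bS p j : before y p j.+1 <-> before x (p + i) j.
  rewrite /before marker_shift (_ : _ + _ = (p + i, - j%:Z)) //.
  by congr pair; rewrite intS opprD addrAC addNr add0r.
have aS p j : after y p j <-> after x (p + i) j.+1.
  rewrite /after marker_shift (_ : _ + _ = (p + i, j.+2%:Z)) //.
  by congr pair; rewrite addrC -intS.
(* If level 1 carries a marker [q], t must already equal [q] at level 0, so [b] is [false].
   Otherwise the same two markers stay nearest. *)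
have [[q ax0]|nax0] := pselect (exists q, after x q 0).
  have vE : v = Some (q, 0%N).
    apply: nearest_uniq nv _ => [p r j|]; [exact: marker_level|by split].
  have [w nw] := nearest_exists (after y).
  exists false, (Some (q - i, 0%N), w); split=> //=.
    by split=> //; apply/b0; rewrite subrK.
  subst v; rewrite addr0.
  have -> : (if w is Some (r, _) then q - i + (minn 0 (gap (q - i) r))%:R else q - i)
      = q - i by case: w {nw} => [[? ?]|] //; rewrite min0n addr0.
  (* The two markers are [j.+1] levels apart, so separation gives [k <= j.+1]; as the gap is below
     [k], it is at most [j] and the climb is complete. *)
  case: u nu {nz} => [[p j]|] //= [bp _].
  have : (k <= j.+1)%N.
    rewrite leqNgt; apply/negP => jk.
    suff [] : p = q /\ j.+1 = 0%N by [].
    by apply: (marker_separated jk bp); rewrite intS addrCA addNr addr0.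
  move=> kj; have gk := gap_lt p q; rewrite (minn_idPr _); last by lia.
  by rewrite natr_Zp addrCA subrr addr0.
(* One level up, the marker below recedes by one and the marker above comes closer by one. The
   truncated predecessor is harmless, since index 0 in [after] means level 1, which has no marker
   here. *)
pose up := omap (fun pj : 'Z_k * nat => (pj.1, pj.2.+1)).
pose down := omap (fun pj : 'Z_k * nat => (pj.1, pj.2.-1)).
have nuy : nearest (before y) (up (rotate i u)).
  case: u nu {nz} => [[p j]|] /=.
    move=> [bp jmin]; split; first by apply/bS; rewrite subrK.
    move=> q [|l] lj; first by move=> /b0 h; apply: nax0; exists (q + i).
    by move=> /bS; exact: jmin.
  move=> nb p [|j]; first by move=> /b0 h; apply: nax0; exists (p + i).
  by move=> /bS; exact: nb.
have nvy : nearest (after y) (down (rotate i v)).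
  case: v nv {nz} => [[p [|j]]|] /=.
  - by case=> ap; case: nax0; exists p.
  - move=> [ap jmin]; split; first by apply/aS; rewrite subrK.
    by move=> q l lj /aS; exact: jmin.
  - by move=> na p j /aS; exact: na.
suff [b bE] : exists b : bool, interpolate (up (rotate i u)) (down (rotate i v))
    = interpolate u v - i + b%:R.
  by exists b, (up (rotate i u), down (rotate i v)).
rewrite -interpolate_rotate //.
case: u {nu nz nuy} => [[p j]|]; case: v {nv nvy} => [[q l]|] /=;
  try by exists false; rewrite addr0.
(* [minn j.+1 d] exceeds [minn j d] by one exactly when [j < d], that is, while t is still
   climbing. *)
move: (gap _ _) => d; exists (j < d)%N.
rewrite -[RHS]addrA -natrD; congr (_ + _%:R).
by lia.
Qed.

Lemma borel_nearest (f : F2 (Gamma k) -> 'Z_k -> nat -> Prop) u :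
  (forall p j, borel_pred (fun z => f z p j)) ->
  borel_pred (fun z => nearest (f z) u).
Proof.
move=> bf; case: u => [[p j]|] /=.
  apply: borel_pred_and; first exact: bf.
  apply: borel_pred_forall => q; apply: borel_pred_forall => l.
  by apply: borel_pred_imply; apply: borel_pred_not; exact: bf.
apply: borel_pred_forall => p; apply: borel_pred_forall => j.
by apply: borel_pred_not; exact: bf.
Qed.

Lemma borel_rotation t :
  borel_pred (fun x : F2 (Gamma k) => rotation (set_val x) t).
Proof.
apply: borel_pred_exists => -[u v] /=.
rewrite (_ : (fun _ => _) = (fun x : F2 (Gamma k) =>
    nearest (before (set_val x)) u /\
    (nearest (after (set_val x)) v /\ t = interpolate u v))); last first.
  by apply/funext => x; apply/propext; split=> [[]|[? []]].
apply: borel_pred_and; first by apply: borel_nearest => p j; exact: borel_marker.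
apply: borel_pred_and; last exact: borel_pred_cst.
by apply: borel_nearest => p j; exact: borel_marker.
Qed.

End Rotation.

(** * The upper and lower bounds *)

Lemma shift_graph_colorable (k : nat) : (1 < k)%N ->
  borel_colorable (shift_graph (Gamma_gens k)) k.
Proof.
(* For [k] of the form [n.+2], the types ['Z_k] and ['I_k] are convertible, so residues serve as
   colours. *)
case: k => [|[|n]] // k_gt1.
have [t tP] := choice (fun x : F2 (Gamma n.+2) => rotation_exists (set_val x)).
have freeP (x : F2 (Gamma n.+2)) : free_part _ (set_val x) by exact: set_valP.
pose c x : 'I_n.+2 := (- t x)%R.
exists c.
  (* Although [t] comes from choice, uniqueness of the rotation makes this preimage a finite union
     of Borel sets. *)
  move=> A; have -> : c @^-1` A =
      [set x | exists s : 'Z_n.+2, rotation (set_val x) s /\ A (- s)%R].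
    apply/seteqP; split=> x /=; first by exists (t x).
    by move=> [s [rs As]]; rewrite /c (rotation_uniq k_gt1 (tP x) rs).
  apply: borel_pred_exists => s; apply: borel_pred_and.
    exact: borel_rotation.
  exact: borel_pred_cst.
(* Along [(i, 1)] the rotation changes by [b - i] with [b] in {0, 1}, which is nonzero exactly
   because [i] avoids 0 and 1. *)
have step (x y : F2 (Gamma n.+2)) (i : 'Z_n.+2) : (i <> 0)%R -> (i <> 1)%R ->
    shift (gam (i, 1%R)) (set_val x) = set_val y -> t x <> t y.
  move=> i0 i1 xy; have [b] := rotation_step k_gt1 i (freeP x) (tP x).
  rewrite xy => /(rotation_uniq k_gt1 (tP y)) ->.
  rewrite -addrA => /eqP; rewrite eq_sym -subr_eq0 addrAC subrr add0r addrC subr_eq0.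
  by case: b => /eqP e; [apply: i1|apply: i0].
move=> x y [_ [s Ss xy]] /oppr_inj txy.
case: Ss xy => [[i i0 ->]|[i [i0 i1] ->]|[i [i0 i1] ->]] xy.
- have := rotation_clique i (freeP x) (tP x).
  rewrite [shift _ _]xy => /(rotation_uniq k_gt1 (tP y)) /eqP.
  by rewrite -txy eq_sym -subr_eq0 addrAC subrr add0r oppr_eq0 => /eqP.
- exact: (step x y i i0 i1 xy).
(* [(- i, -1)] is the inverse of [(i, 1)], so the edge is read from [y] to [x]. *)
- apply: (step y x i i0 i1 _ (esym txy)); rewrite -xy.
  rewrite -[LHS]/(shift _ (shift (gam (- i, -1)%R) _)) shiftM gamM.
  rewrite (_ : _ + _ = 0)%R; last by congr pair; rewrite addrN.
  exact: shift1.
Qed.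

(** The point masses at the elements [(i, 0)] form a [k]-clique: any two differ by a generator
    [(j - i, 0)], so their colours are distinct. *)
Lemma shift_graph_clique (k m : nat) : (1 < k)%N ->
  borel_colorable (shift_graph (Gamma_gens k)) m -> (k <= m)%N.
Proof.
move=> k_gt1 [c _ cP].
pose f (i : 'Z_k) := c (free_point_mass (gam (i, 0)%R)).
suff /leq_card : injective f by rewrite !card_ord Zp_cast.
move=> i j fij; apply: contrapT => ij; apply: cP fij; split.
  by move=> /(congr1 set_val)/point_mass_inj/(congr1 fst).
exists (gam (j - i, 0)%R).
  by apply: Or31; exists (j - i)%R => // /subr0_eq /esym.
rewrite shift_point_mass gamM; congr point_mass.
by congr pair; rewrite subrK.
Qed.

Theorem theorem4 (k : nat) (hk : (3 <= k)%N) :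
  borel_chromatic_number_eq (shift_graph (Gamma_gens k)) k.
Proof.
have k_gt1 : (1 < k)%N by exact: leq_trans hk.
by split=> [|m]; [exact: shift_graph_colorable|exact: shift_graph_clique].
Qed.
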